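(* Let $G$ be a graph of order $n$ containing at least one edge. The dependence polynomial $D(G,x)$ has only real roots if and only if $G$ is isomorphic to one of $$K_2\cup(n-2)K_1,\ P_3\cup(n-3)K_1,\ K_3\cup(n-3)K_1,\ 2K_2\cup(n-4)K_1,\ P_4\cup(n-4)K_1,\ C_4\cup(n-4)K_1,\ G_1\cup(n-4)K_1,\ G_2\cup(n-5)K_1.$$
   Context: Graphs are finite, simple, undirected. A dependent set of $G$ is a set $S\subseteq V(G)$ whose induced subgraph contains at least one edge; $d_k(G)$ is the number of dependent sets of size $k$ and $D(G,x):=\sum_{k\geqslant0}d_k(G)x^k$. $K_m$, $P_m$, $C_m$ denote the complete graph, path and cycle on $m$ vertices; $G\cup H$ is disjoint union and $mH$ is the disjoint union of $m$ copies of $H$ (with $0K_1$ the empty graph). $G_1$ is the graph on vertices $u,v,x_1,x_2$ with edges $uv,ux_1,vx_1,vx_2$ (a triangle with one pendant edge). $G_2$ is the tree on vertices $v,u,x_1,x_2,x_3$ with edges $vu,vx_2,vx_3,ux_1$ (the star $K_{1,3}$ with one edge subdivided). *)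

(* Defs.v *)
From HB Require Import structures.
From mathcomp Require Import all_boot all_order all_algebra.
From mathcomp Require Import reals.
From mathcomp Require Import complex.

Set Implicit Arguments.
Unset Strict Implicit.
Unset Printing Implicit Defensive.

Import GRing.Theory.
Local Open Scope ring_scope.

Record sgraph := SGraph {
  vertex :> finType;
  adj : rel vertex;
  adj_sym : symmetric adj;
  adj_irr : irreflexive adj
}.

Definition giso (G H : sgraph) : Prop :=
  exists2 f : G -> H, bijective f & forall x y : G, adj (f x) (f y) = adj x y.

Definition dependent (G : sgraph) (S : {set G}) : bool :=
  [exists x in S, exists y in S, adj x y].

Definition dep_count (G : sgraph) (k : nat) : nat :=
  #|[set S : {set G} | dependent S & #|S| == k]|.

(* No set of vertices has more than #|G| elements, so the sum over all k >= 0
   is finite. *)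
Definition dep_poly (A : nzRingType) (G : sgraph) : {poly A} :=
  \sum_(k < #|G|.+1) (dep_count G k)%:R *: 'X^k.

Definition only_real_roots (R : rcfType) (p : {poly R[i]}) : Prop :=
  forall z : R[i], root p z -> z \is Num.real.

Section DisjointUnion.
Variables G H : sgraph.

Definition gunion_adj (x y : G + H) : bool :=
  match x, y with
  | inl a, inl b => adj a b
  | inr a, inr b => adj a b
  | _, _ => false
  end.

Lemma gunion_adj_sym : symmetric gunion_adj.
Proof. by case=> a [] b //=; rewrite adj_sym. Qed.

Lemma gunion_adj_irr : irreflexive gunion_adj.
Proof. by case=> a /=; rewrite adj_irr. Qed.

Definition gunion : sgraph := SGraph gunion_adj_sym gunion_adj_irr.
End DisjointUnion.

Section Copies.
Variables (m : nat) (H : sgraph).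

Definition gcopies_adj (x y : 'I_m * H) : bool :=
  (x.1 == y.1) && adj x.2 y.2.

Lemma gcopies_adj_sym : symmetric gcopies_adj.
Proof. by move=> x y; rewrite /gcopies_adj eq_sym adj_sym. Qed.

Lemma gcopies_adj_irr : irreflexive gcopies_adj.
Proof. by move=> x; rewrite /gcopies_adj adj_irr andbF. Qed.

Definition gcopies : sgraph := SGraph gcopies_adj_sym gcopies_adj_irr.
End Copies.

(* The simple graph on 'I_m whose edges are the pairs {i, j}, i != j, with
   e i j or e j i. *)
Section OrdinalGraph.
Variables (m : nat) (e : rel nat).

Definition ord_adj (i j : 'I_m) : bool := (i != j) && (e i j || e j i).

Lemma ord_adj_sym : symmetric ord_adj.
Proof. by move=> i j; rewrite /ord_adj eq_sym orbC. Qed.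

Lemma ord_adj_irr : irreflexive ord_adj.
Proof. by move=> i; rewrite /ord_adj eqxx. Qed.

Definition ord_graph : sgraph := SGraph ord_adj_sym ord_adj_irr.
End OrdinalGraph.

Definition K_ (m : nat) : sgraph := ord_graph m (fun _ _ => true).

Definition P_ (m : nat) : sgraph := ord_graph m (fun i j => i.+1 == j).

(* A cycle for m >= 3 only. *)
Definition C_ (m : nat) : sgraph := ord_graph m (fun i j => i.+1 %% m == j)%N.

(* u, v, x1, x2 are numbered 0, 1, 2, 3. *)
Definition G1 : sgraph :=
  ord_graph 4 (fun i j => (i, j) \in [:: (0, 1); (0, 2); (1, 2); (1, 3)]%N).

(* v, u, x1, x2, x3 are numbered 0, 1, 2, 3, 4. *)
Definition G2 : sgraph :=
  ord_graph 5 (fun i j => (i, j) \in [:: (0, 1); (0, 3); (0, 4); (1, 2)]%N).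

(* Main.v *)
Require Import Defs.
From HB Require Import structures.
From mathcomp Require Import all_boot all_order all_algebra.
From mathcomp Require Import reals.
From mathcomp Require Import complex.
From mathcomp Require Import ring zify.

(** Suppose that D(G, x) has only real roots.  If no vertex covers all the
    edges, then the three top coefficients of D are 1, n and C(n, 2) - i, where
    i is the number of vertex covers of size 2.  As 0 is a double root,
    Cauchy-Schwarz on the other n - 2 roots forces i >= 2.  Two vertex covers
    {u, v}, {u, w} leave only a star at u together with the edge vw; two
    disjoint ones leave a subgraph of C4, which is C4 itself or again of the
    previous kind.

    With y = 1 + x and t the number of neighbours of u other than v and w, the
    star with an edge has, up to the factor x and a power of y,
    D = y^(t+2) + y^(t+1) - y^t - c where c is 1, y or 2y - 1.  For large t the
    squares of the roots (up to a factor y when c = y) have sum 3 and product 1,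
    so AM-GM leaves at most 3 roots.  In the same way the star with d edges,
    for which D is y^d - 1, needs d <= 2. *)

Set Implicit Arguments.
Unset Strict Implicit.
Unset Printing Implicit Defensive.

Import Order.TTheory GRing.Theory Num.Theory.
Local Open Scope ring_scope.

(** * Power sums of roots and real-rooted polynomials *)

(** Newton's identity for the second power sum: the two coefficients are -e1 and e2 in the
    elementary symmetric functions, so the right side is e1^2 - 2 e2. *)
Lemma sum_sqr_prod_XsubC (A : comNzRingType) (rs : seq A) : (1 < size rs)%N ->
  let p := \prod_(r <- rs) ('X - r%:P) in
  \sum_(r <- rs) r ^+ 2 = p`_(size rs).-1 ^+ 2 - p`_(size rs - 2) *+ 2.
Proof.
elim: rs => [//|a [//|b rs] IH] _ /=.
rewrite subn2 /= !(big_cons _ _ a).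
set p := \prod_(r <- b :: rs) _.
rewrite mulrBl !coefB !coefCM !coefXM /=.
have e1 : p`_(size rs) = - \sum_(r <- b :: rs) r.
  exact: (@coefPn_prod_XsubC _ (b :: rs)).
have e0 : p`_(size rs).+1 = 1.
  have /monicP := monic_prod_XsubC (b :: rs) predT id.
  by rewrite lead_coefE size_prod_XsubC.
rewrite e0 e1 {e0}; case: rs IH @p e1 => [|c rs] IH p e1 /=.
  by rewrite !big_cons !big_nil; ring.
rewrite (IH isT) /= subn2 /= e1; ring.
Qed.

Section RealRooted.
Variable C : numClosedFieldType.

(** At [R[i]] this unfolds to the same statement as [only_real_roots]; the argument works in any
    closed numeric field. *)
Definition real_rooted (p : {poly C}) : Prop :=
  forall z : C, root p z -> z \is Num.real.

Lemma real_rooted_split (p : {poly C}) : p \is monic -> real_rooted p ->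
  exists2 rs : seq C, p = \prod_(r <- rs) ('X - r%:P) & {in rs, forall r, r \is Num.real}.
Proof.
move=> /monicP mp rp; have [rs e] := closed_field_poly_normal p.
rewrite mp scale1r in e; exists rs => // r rin.
by apply: rp; rewrite e root_prod_XsubC.
Qed.

(** Cauchy-Schwarz against the all-ones vector. Prepending [a] raises the gap between the two sides
    by exactly the sum of the [(a - r) ^+ 2], which is nonnegative because the entries are real. *)
Lemma sqr_sum_le (rs : seq C) : {in rs, forall r, r \is Num.real} ->
  (\sum_(r <- rs) r) ^+ 2 <= (size rs)%:R * \sum_(r <- rs) r ^+ 2.
Proof.
elim: rs => [|a rs IH] rR; first by rewrite !big_nil mulr0 expr0n.
have aR : a \is Num.real by apply: rR; rewrite mem_head.
have {}rR : {in rs, forall r, r \is Num.real}.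
  by move=> r rin; apply: rR; rewrite inE rin orbT.
have h : 0 <= \sum_(r <- rs) (a - r) ^+ 2.
  rewrite big_seq; apply: sumr_ge0 => r rin.
  by rewrite -realEsqr rpredB ?aR ?(rR _ rin).
have e : \sum_(r <- rs) (a - r) ^+ 2 =
    (size rs)%:R * a ^+ 2 - 2 * a * (\sum_(r <- rs) r) + \sum_(r <- rs) r ^+ 2.
  elim: {IH rR h} rs => [|b rs IH]; first by rewrite !big_nil /=; ring.
  by rewrite !big_cons IH /= -[in RHS]natr1; ring.
rewrite !big_cons /= -natr1 -subr_ge0.
have {}IH := IH rR; rewrite -subr_ge0 in IH; rewrite e in h.
move: (addr_ge0 h IH); congr (0 <= _); ring.
Qed.

Lemma prod_XsubC_coef0_eq0 (rs : seq C) :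
  (\prod_(r <- rs) ('X - r%:P))`_0 = 0 -> exists rs', perm_eq rs (0 :: rs').
Proof.
rewrite -horner_coef0 => /eqP; rewrite -/(root _ _) root_prod_XsubC => h.
by exists (rem 0 rs); apply: perm_to_rem.
Qed.

(* Cauchy-Schwarz for the [n] roots that remain once the double root 0 is
   removed. *)
Lemma real_rooted_double_zero (p : {poly C}) (n : nat) :
    p \is monic -> size p = n.+3 -> p`_0 = 0 -> p`_1 = 0 -> real_rooted p ->
  p`_n.+1 ^+ 2 <= n%:R * (p`_n.+1 ^+ 2 - p`_n *+ 2).
Proof.
move=> mp sp p0 p1 /(real_rooted_split mp) [rs e rR].
have szrs : size rs = n.+2 by move: sp; rewrite e size_prod_XsubC => -[].
have := @sum_sqr_prod_XsubC _ rs; rewrite szrs => /(_ isT) /=.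
rewrite -e subn2 /= => <-.
have := @coefPn_prod_XsubC _ rs; rewrite szrs => /(_ isT) /=; rewrite -e => ->.
(* The vanishing coefficients 0 and 1 remove two zeros from the list of roots, one after the
   other. *)
have [rs1 pe1] := prod_XsubC_coef0_eq0 (etrans (f_equal (fun q : {poly C} => q`_0) (esym e)) p0).
rewrite (perm_big _ pe1) big_cons /= subr0 in e.
move: p1; rewrite e coefXM /= => /prod_XsubC_coef0_eq0 [rs2 pe2].
have pe : perm_eq rs [:: 0, 0 & rs2] by rewrite (perm_trans pe1) ?perm_cons.
have sz2 : size rs2 = n by move: (perm_size pe); rewrite szrs => -[].
rewrite sqrrN !(perm_big _ pe) !big_cons expr0n /= !add0r -sz2; apply: sqr_sum_le => r rin.
by apply: rR; rewrite (perm_mem pe) !inE rin !orbT.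
Qed.

(* AM-GM applied to the squares of the roots, whose product is 1. *)
Lemma real_rooted_size_le (p : {poly C}) (k : nat) :
    p \is monic -> size p = k.+3 -> p`_0 ^+ 2 = 1 -> real_rooted p ->
  k.+2%:R <= p`_k.+1 ^+ 2 - p`_k *+ 2.
Proof.
move=> mp sp p0 /(real_rooted_split mp) [rs e rR].
have szrs : size rs = k.+2 by move: sp; rewrite e size_prod_XsubC => -[].
have := @sum_sqr_prod_XsubC _ rs; rewrite szrs => /(_ isT) /=.
rewrite -e subn2 /= => <-.
set Q := \sum_(r <- rs) r ^+ 2.
have rR2 r : r \in rs -> 0 <= r ^+ 2 by move/rR; rewrite realEsqr.
have Q0 : 0 <= Q by rewrite /Q big_seq; apply: sumr_ge0 => r /rR2.
have := @leif_AGM C 'I_(size rs) predT (fun i => rs`_i ^+ 2).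
rewrite card_ord szrs => /(_ _) H.
have {H} [|H _] := H; first by move=> i _; apply/rR2/mem_nth; rewrite szrs.
move: H; rewrite -szrs.
rewrite -(big_mkord predT (fun i => rs`_i ^+ 2)) -(big_nth 0 predT (fun r => r ^+ 2)).
rewrite -(big_mkord predT (fun i => rs`_i ^+ 2)) -(big_nth 0 predT (fun r => r ^+ 2)).
have -> : \prod_(r <- rs) r ^+ 2 = 1.
  by move: p0; rewrite e coef0_prod_XsubC exprMn sqrr_sign mul1r prodrXl.
(* AM-GM now bounds 1 by the power [k.+2] of the mean [Q / k.+2%:R], so this mean is at least 1. *)
rewrite -/Q szrs => H.
rewrite -[Q](divfK (_ : k.+2%:R != 0)) ?pnatr_eq0 // ler_peMl ?ler0n //.
by rewrite -(@expr_ge1 _ k.+2) ?divr_ge0 ?ler0n.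
Qed.

End RealRooted.

(** * Weighted sums over families of sets, and values of the dependence polynomial *)

(** Membership is decided element by element: forced elements give a factor z, forbidden ones a
    factor 1, free ones 1 + z. *)
Lemma sum_cylinder (A : comNzRingType) (T : finType) (B C : {set T}) (z : A) :
    [disjoint B & C] ->
  \sum_(S : {set T} | (B \subset S) && [disjoint S & C]) z ^+ #|S| =
  z ^+ #|B| * (1 + z) ^+ (#|T| - #|B| - #|C|).
Proof.
move=> dBC.
(* In each factor the first summand is the weight of taking [i] into [S], the second that of leaving
   it out; a forbidden choice weighs 0. *)
have -> : \sum_(S : {set T} | (B \subset S) && [disjoint S & C]) z ^+ #|S| =
    \prod_(i : T) ((if i \in C then 0 else z) + (if i \in B then 0 else 1)).
  rewrite bigA_distr big_mkcond /=; apply: eq_bigr => S _.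
  case: ifPn => [/andP[sBS dSC]|].
    rewrite -prodr_const big_mkcond /=; apply: eq_bigr => i _.
    case: ifPn => [iS|niS]; first by rewrite (disjointFr dSC).
    by rewrite (contraNF (subsetP sBS i)).
  rewrite negb_and => /orP[/subsetPn[i iB niS]|/pred0Pn[i /andP[/= iS iC]]].
    by rewrite (bigD1 i) //= (negbTE niS) iB mul0r.
  by rewrite (bigD1 i) //= iS iC mul0r.
rewrite (bigID (mem B)) /= -prodr_const; congr (_ * _).
  by apply: eq_bigr => i iB; rewrite iB (disjointFr dBC) ?addr0.
rewrite (bigID (mem C)) /= big1 ?mul1r => [|i /andP[niB iC]]; last first.
  by rewrite iC (negbTE niB) add0r.
rewrite (eq_bigr (fun=> 1 + z)) => [|i /andP[niB niC]]; last first.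
  by rewrite (negbTE niB) (negbTE niC) addrC.
rewrite -subnDA; move: dBC; rewrite -leq_card_setU => /eqP <-.
rewrite -[in X in _ ^+ X](setCK (B :|: C)) -cardsCs.
by rewrite -prodr_const; apply: eq_bigl => i; rewrite !inE negb_or.
Qed.

Lemma coef_dep_poly (A : nzRingType) (G : sgraph) (k : nat) :
  (dep_poly A G)`_k = (dep_count G k)%:R.
Proof.
rewrite /dep_poly coef_sum.
have [lek|ltk] := ltnP k #|G|.+1.
  rewrite (bigD1 (Ordinal lek)) //= coefZ coefXn eqxx mulr1 big1 ?addr0 // => i.
  by rewrite coefZ coefXn -val_eqE /= eq_sym => /negbTE ->; rewrite mulr0.
rewrite big1 => [|i _]; last first.
  by rewrite coefZ coefXn gtn_eqF ?mulr0 // (leq_trans (ltn_ord i)).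
rewrite /dep_count (_ : [set _ | _] = set0) ?cards0 //.
apply/setP => S; rewrite !inE; apply/negP => /andP[_ /eqP e].
by move: ltk; rewrite -e ltnNge max_card.
Qed.

(** Only roots matter, so all closed forms of D are proved pointwise from this sum over dependent
    sets. *)
Lemma horner_dep_poly (A : comNzRingType) (G : sgraph) (z : A) :
  (dep_poly A G).[z] = \sum_(S : {set G} | dependent S) z ^+ #|S|.
Proof.
rewrite /dep_poly horner_sum.
rewrite (partition_big (fun S : {set G} => inord #|S| : 'I_#|G|.+1) predT) //=.
apply: eq_bigr => k _; rewrite hornerZ hornerXn /dep_count.
rewrite mulr_natl -sumr_const; apply: eq_big => [S|S].
  by rewrite inE -val_eqE /= inordK // ltnS max_card.
by rewrite inE => /andP[_ /eqP <-].
Qed.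

Section Vertex.
Variables (G : sgraph).
Implicit Types u v w : G.

Definition nbr u : {set G} := [set x | adj u x].

Lemma disjoint_nbr u : [disjoint [set u] & nbr u].
Proof. by rewrite disjoints1 inE adj_irr. Qed.

Definition star_at u : Prop := forall x y, adj x y -> (x == u) || (y == u).

(** A star at [u] with one further edge off [u]. Whether [u] is adjacent to both, one or neither of
    [v] and [w] is left open and gives the three cases of the later formulas. *)
Definition edge_star u v w : Prop :=
  [/\ adj v w, v != u, w != u &
      forall x y, adj x y -> [|| x == u, y == u, (x == v) && (y == w) | (x == w) && (y == v)]].

Lemma dependentP (S : {set G}) :
  reflect (exists x y, [/\ x \in S, y \in S & adj x y]) (dependent S).
Proof.
apply: (iffP exists_inP) => [[x xS /exists_inP [y yS xy]]|[x [y [xS yS xy]]]].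
  by exists x, y.
by exists x => //; apply/exists_inP; exists y.
Qed.

Lemma dependent_nbr u (S : {set G}) : u \in S -> ~~ [disjoint S & nbr u] -> dependent S.
Proof.
move=> uS; rewrite disjoint_sym => /pred0Pn [x /andP[/= xu xS]].
by apply/dependentP; exists u, x; split=> //; rewrite inE in xu.
Qed.

Lemma dependent_star u (S : {set G}) : star_at u ->
  dependent S = (u \in S) && ~~ [disjoint S & nbr u].
Proof.
move=> st; apply/idP/andP => [/dependentP[x [y [xS yS xy]]]|[]]; last first.
  exact: dependent_nbr.
case/orP: (st _ _ xy) => /eqP e; subst u; split=> //.
  by apply/pred0Pn; exists y; rewrite /= yS inE.
by apply/pred0Pn; exists x; rewrite /= xS inE adj_sym.
Qed.

Lemma dependent_edge_star u v w (S : {set G}) : edge_star u v w ->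
  dependent S = ([set v; w] \subset S) || (u \in S) && ~~ [disjoint S & nbr u].
Proof.
move=> [vw vu wu es]; apply/idP/idP => [/dependentP[x [y [xS yS xy]]]|].
  have [/eqP e|/eqP e|/andP[/eqP ex /eqP ey]|/andP[/eqP ex /eqP ey]] := or4P (es _ _ xy).
  - subst u; rewrite xS /= orbC; apply/orP; left.
    by apply/pred0Pn; exists y; rewrite /= yS inE.
  - subst u; rewrite yS /= orbC; apply/orP; left.
    by apply/pred0Pn; exists x; rewrite /= xS inE adj_sym.
  - by rewrite subUset !sub1set -ex -ey xS yS.
  - by rewrite subUset !sub1set -ex -ey xS yS.
case/orP=> [|/andP[]]; last exact: dependent_nbr.
rewrite subUset !sub1set => /andP[vS wS].
by apply/dependentP; exists v, w.
Qed.

Variable A : comNzRingType.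
Implicit Type z : A.

(** The dependent sets are the sets containing [u], less those that also avoid every neighbour of
    [u]. *)
Lemma dep_eval_star u z : star_at u ->
  (dep_poly A G).[z] =
  z * (1 + z) ^+ (#|G| - 1 - #|nbr u|) * ((1 + z) ^+ #|nbr u| - 1).
Proof.
move=> st; rewrite horner_dep_poly.
under eq_bigl do rewrite (dependent_star _ st).
have d0 (B : {set G}) : [disjoint B & (set0 : {set G})] by rewrite -setI_eq0 setI0.
have c0 := @sum_cylinder A G [set u] set0 z (d0 _).
have c1 := @sum_cylinder A G [set u] (nbr u) z (disjoint_nbr u).
rewrite ?cards0 ?cards1 ?subn0 ?expr1 in c0 c1.
rewrite mulrBr mulr1 -mulrA -exprD.
have -> : (#|G| - 1 - #|nbr u| + #|nbr u| = #|G| - 1)%N.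
  rewrite subnK //; have := disjoint_nbr u; rewrite -leq_card_setU cards1 => /eqP e.
  by have := max_card (mem ([set u] :|: nbr u)); rewrite e; lia.
rewrite big_mkcond /= in c0; rewrite big_mkcond /= in c1.
(* All terms are now sums over all sets, so the identity is checked on the indicators of a single
   set. *)
rewrite -c0 -c1 [LHS]big_mkcond -sumrB; apply: eq_bigr => S _.
rewrite sub1set d0; case: (u \in S); case: [disjoint _ & _] => /=; ring.
Qed.

(** Inclusion-exclusion between containing [v] and [w], and containing [u] with a neighbour of [u].
    The conditional term counts the sets that contain [u], [v], [w] and avoid all neighbours of [u];
    they exist only if [u] is adjacent to neither [v] nor [w]. *)
Lemma dep_eval_edge_star u v w z : edge_star u v w ->
  let y := 1 + z in let d := #|nbr u| in
  (dep_poly A G).[z] = z * y ^+ (#|G| - 1) - z * y ^+ (#|G| - 1 - d) +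
    z ^+ 2 * y ^+ (#|G| - 2) - z ^+ 3 * y ^+ (#|G| - 3) +
    (if ~~ adj u v && ~~ adj u w then z ^+ 3 * y ^+ (#|G| - 3 - d) else 0).
Proof.
move=> es y d; rewrite horner_dep_poly.
under eq_bigl do rewrite (dependent_edge_star _ es).
case: es => vw vu wu _.
have nvw : v != w by apply: contraTneq vw => ->; rewrite adj_irr.
have s2 : #|[set v; w]| = 2 by rewrite cards2 nvw.
have s3 : #|u |: [set v; w]| = 3 by rewrite cardsU1 s2 !inE negb_or eq_sym vu eq_sym wu.
have d0 (B : {set G}) : [disjoint B & (set0 : {set G})] by rewrite -setI_eq0 setI0.
have c0 := @sum_cylinder A G [set u] set0 z (d0 _).
have c1 := @sum_cylinder A G [set u] (nbr u) z (disjoint_nbr u).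
have c2 := @sum_cylinder A G [set v; w] set0 z (d0 _).
have c3 := @sum_cylinder A G (u |: [set v; w]) set0 z (d0 _).
rewrite ?cards0 ?cards1 ?s2 ?s3 ?subn0 ?expr1 in c0 c1 c2 c3.
have c4 : (if ~~ adj u v && ~~ adj u w then z ^+ 3 * y ^+ (#|G| - 3 - d) else 0) =
    \sum_(S : {set G} | (u |: [set v; w] \subset S) && [disjoint S & nbr u]) z ^+ #|S|.
  case: ifPn => [/andP[nuv nuw]|].
    rewrite sum_cylinder ?s3 //; apply/pred0P => x /=; apply/negbTE; rewrite !inE.
    by apply/negP => /andP[/or3P[] /eqP ->]; apply/negP; rewrite ?adj_irr.
  rewrite negb_and !negbK => uvw; rewrite big1 // => S /andP[].
  rewrite !subUset !sub1set => /and3P[uS vS wS] /pred0P /(_ (if adj u v then v else w)) /=.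
  by rewrite inE; case: ifP uvw => /= [->|_ ->]; rewrite ?vS ?wS.
rewrite big_mkcond /= in c0; rewrite big_mkcond /= in c1; rewrite big_mkcond /= in c2.
rewrite big_mkcond /= in c3; rewrite [in RHS]big_mkcond /= in c4.
rewrite c4 -c0 -c1 -c2 -c3 [LHS]big_mkcond -sumrB -big_split -sumrB -big_split /=.
apply: eq_bigr => S _.
rewrite !subUset !sub1set d0; case: (u \in S); case: (v \in S); case: (w \in S);
  case: [disjoint _ & _] => /=; ring.
Qed.

(** [E] and [F] are the sides of a complete bipartite graph, so a set is dependent iff it meets
    both; inclusion-exclusion over the sets missing a side gives the formula. *)
Lemma dep_eval_C4 (E F : {set G}) z : [disjoint E & F] -> #|E| = 2 -> #|F| = 2 ->
  (forall x y, adj x y = (x \in E) && (y \in F) || (x \in F) && (y \in E)) ->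
  (dep_poly A G).[z] = (1 + z) ^+ (#|G| - 4) * ((1 + z) ^+ 2 - 1) ^+ 2.
Proof.
move=> dEF sE sF adjE; rewrite horner_dep_poly.
have dep (S : {set G}) : dependent S = ~~ ([disjoint S & E] || [disjoint S & F]).
  rewrite negb_or; apply/idP/idP => [/dependentP[x [y [xS yS]]]|].
    rewrite adjE => /orP[] /andP[xi yi]; apply/andP; split; apply/pred0Pn;
      by [exists x; rewrite /= xS | exists y; rewrite /= yS].
  case/andP=> /pred0Pn [x /andP[/= xS xE]] /pred0Pn [y /andP[/= yS yF]].
  by apply/dependentP; exists x, y; rewrite adjE xE yF.
under eq_bigl do rewrite dep.
have s4 : #|E :|: F| = 4 by have := dEF; rewrite -leq_card_setU sE sF => /eqP.
have g4 : (4 <= #|G|)%N by have := max_card (mem (E :|: F)); rewrite s4.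
have d0 (B : {set G}) : [disjoint (set0 : {set G}) & B] by rewrite -setI_eq0 set0I.
have c0 := @sum_cylinder A G set0 set0 z (d0 _).
have c1 := @sum_cylinder A G set0 E z (d0 _).
have c2 := @sum_cylinder A G set0 F z (d0 _).
have c3 := @sum_cylinder A G set0 (E :|: F) z (d0 _).
rewrite ?cards0 ?sE ?sF ?s4 ?subn0 ?expr0 ?mul1r in c0 c1 c2 c3.
have -> : (1 + z) ^+ (#|G| - 4) * ((1 + z) ^+ 2 - 1) ^+ 2 =
   (1 + z) ^+ #|G| - (1 + z) ^+ (#|G| - 2) - (1 + z) ^+ (#|G| - 2) + (1 + z) ^+ (#|G| - 4).
  by rewrite -(subnK g4) (_ : _ - 2 = (#|G| - 4) + 2)%N ?addnK ?exprD; [ring | lia].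
rewrite big_mkcond /= in c0; rewrite big_mkcond /= in c1; rewrite big_mkcond /= in c2.
rewrite big_mkcond /= in c3.
rewrite -c0 -{1}c1 -c2 -c3 [LHS]big_mkcond -!sumrB -big_split /=.
apply: eq_bigr => S _; rewrite !sub0set.
have -> : [disjoint S & E :|: F] = [disjoint S & E] && [disjoint S & F].
  by rewrite -!setI_eq0 setIUr setU_eq0.
have -> : [disjoint S & (set0 : {set G})] by rewrite disjoint_sym.
by case: [disjoint S & E]; case: [disjoint S & F] => /=; ring.
Qed.
End Vertex.

(** * The star with an edge, described by its number of legs *)

Section EdgeStar.
Variables (G : sgraph) (u v w : G).
Hypothesis es : edge_star u v w.

Lemma edge_star_neq : v != w.
Proof. by case: es => vw _ _ _; apply: contraTneq vw => ->; rewrite adj_irr. Qed.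

Lemma edge_star_adjE (x y : G) :
  adj x y = [|| (x == u) && (y \in nbr u), (y == u) && (x \in nbr u),
                (x == v) && (y == w) | (x == w) && (y == v)].
Proof.
rewrite !inE; case: es => vw _ _ H; apply/idP/idP => [xy|].
  case/or4P: (H _ _ xy) => [/eqP e|/eqP e|->|->]; rewrite ?orbT //; subst u.
    by rewrite eqxx xy.
  by rewrite eqxx adj_sym xy orbT.
case/or4P=> /andP[/eqP-> //]; first by rewrite adj_sym.
  by move/eqP->.
by move/eqP->; rewrite adj_sym.
Qed.

(** These vertices have [u] as their only neighbour; their number is the parameter t of the reduced
    polynomial. *)
Definition legs : {set G} := nbr u :\: [set v; w].

Lemma card_nbr_legs : #|nbr u| = (#|legs| + adj u v + adj u w)%N.
Proof.
rewrite /legs -(cardsID [set v; w] (nbr u)) addnC -addnA; congr (_ + _)%N.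
have -> : nbr u :&: [set v; w] =
    (if adj u v then [set v] else set0) :|: (if adj u w then [set w] else set0).
  apply/setP => x; rewrite !inE; have [->|nv] := eqVneq x v.
    by case: ifP => uv; case: ifP => uw; rewrite !inE ?eqxx ?uv // (negbTE edge_star_neq).
  have [->|nw] := eqVneq x w.
    by case: ifP => uv; case: ifP => uw; rewrite !inE ?eqxx ?uw ?orbT // eq_sym (negbTE edge_star_neq).
  by rewrite andbF; case: ifP => uv; case: ifP => uw; rewrite !inE ?(negbTE nv) ?(negbTE nw).
by do 2![case: ifP => _]; rewrite ?set0U ?setU0 ?cards2 ?cards1 ?cards0 ?edge_star_neq.
Qed.

Lemma card_legs : (#|legs| + 3 <= #|G|)%N.
Proof.
case: es => _ vu wu _.
have d : [disjoint legs & u |: [set v; w]].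
  apply/pred0P => x /=; apply/negbTE; rewrite !inE.
  apply/negP => /andP[/andP[]]; rewrite negb_or => /andP[/negbTE-> /negbTE->]; rewrite !orbF => ux /eqP xu.
  by rewrite xu adj_irr in ux.
have := max_card (mem (legs :|: (u |: [set v; w]))).
move: d; rewrite -leq_card_setU => /eqP->.
by rewrite cardsU1 cards2 edge_star_neq !inE negb_or eq_sym vu eq_sym wu.
Qed.

Lemma dep_eval_legs (A : comNzRingType) (y : A) :
  let t := #|legs| in
  (dep_poly A G).[y - 1] = (y - 1) * y ^+ (#|G| - 3 - t) *
    (y ^+ t.+2 + y ^+ t.+1 - y ^+ t -
     (if adj u v && adj u w then 1 else if adj u v || adj u w then y else 2 * y - 1)).
Proof.
rewrite (dep_eval_edge_star _ es) /= card_nbr_legs.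
(* Writing the order as m + (t + 3) keeps the subtractions in the exponents from truncating. *)
have := card_legs; move: #|legs| => t /subnK <-.
move: (#|G| - (t + 3))%N => m.
rewrite [1 + (y - 1)]addrC subrK.
have -> : (m + (t + 3) - 3 - t = m)%N by lia.
have -> : (m + (t + 3) - 1 = m + t.+2)%N by lia.
have -> : (m + (t + 3) - 2 = m + t.+1)%N by lia.
have -> : (m + (t + 3) - 3 = m + t)%N by lia.
case: (adj u v); case: (adj u w) => /=; rewrite ?addn0 ?addn1.
- by rewrite (_ : m + t.+2 - t.+2 = m)%N ?exprD ?exprS; [ring|lia].
- by rewrite (_ : m + t.+2 - t.+1 = m + 1)%N ?exprD ?exprS; [ring|lia].
- by rewrite (_ : m + t.+2 - t.+1 = m + 1)%N ?exprD ?exprS; [ring|lia].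
(* With [u] adjacent to neither end, -y^2 meets the correction term (y - 1)^2, which leaves -(2y -
   1). *)
- rewrite (_ : m + t.+2 - t = m + 2)%N; last lia.
  by rewrite (_ : m + t - t = m)%N ?exprD ?exprS; [ring|lia].
Qed.

End EdgeStar.

(** * Degree bounds from AM-GM *)

Section Bounds.
Variable C : numClosedFieldType.

(** The squares of the roots sum to 1 + 2 = 3, fewer than the t + 4 roots. The exponents start at 2
    so that [q] leaves the three top coefficients alone. *)
Lemma edge_star_poly_not_real_rooted (t : nat) (q : {poly C}) :
    (size q <= 2)%N -> q`_0 ^+ 2 = 1 ->
  ~ real_rooted ('X^(t.+4) + 'X^(t.+3) - 'X^(t.+2) - q).
Proof.
move=> sq q0 rr; set p := (X in real_rooted X) in rr.
have sp1 : (size ('X^(t.+3) - 'X^(t.+2) - q)%R < size ('X^(t.+4) : {poly C})%R)%N.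
  rewrite size_polyXn ltnS (leq_trans (size_polyD _ _)) // size_polyN geq_max.
  rewrite (leq_trans (size_polyD _ _)) ?size_polyN ?size_polyXn ?geq_max ?leqnn ?leqnSn //=.
  by rewrite (leq_trans sq).
have pE : p = 'X^(t.+4) + ('X^(t.+3) - 'X^(t.+2) - q) by rewrite /p; ring.
have mp : p \is monic by rewrite monicE pE lead_coefDl // lead_coefXn.
have sp : size p = t.+2.+3 by rewrite pE size_polyDl // size_polyXn.
have qz k : (1 < k)%N -> q`_k = 0 by move=> k2; rewrite nth_default // (leq_trans sq).
have e0 : p`_0 ^+ 2 = 1 by rewrite !(coefD, coefN, coefXn) /= subr0 !add0r sqrrN.
have e1 : p`_t.+3 = 1.
  by rewrite !(coefD, coefN, coefXn) qz // !eqSS !eqxx (ltn_eqF (ltnSn _)) (gtn_eqF (ltnSn _)) /=; ring.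
have e2 : p`_t.+2 = - 1.
  rewrite !(coefD, coefN, coefXn) qz // !eqSS !eqxx (ltn_eqF (ltnSn _)).
  by rewrite (ltn_eqF (ltnW (ltnSn _))) /=; ring.
have := real_rooted_size_le mp sp e0 rr; rewrite e1 e2.
have -> : 1 ^+ 2 - (- 1) *+ 2 = 3%:R :> C by ring.
by rewrite ler_nat.
Qed.

(** From degree 3 on, the two coefficients below the leading one vanish and the squares of the roots
    sum to 0. In degree 2 the lower of them is the constant term -1. *)
Lemma XnsubC1_not_real_rooted (d : nat) : ~ real_rooted ('X^(d.+3) - 1%:P : {poly C}).
Proof.
move=> rr; have := @real_rooted_size_le _ _ d.+1 (monicXnsubC 1 (isT : 0 < d.+3)%N) _ _ rr.
rewrite size_XnsubC // !(coefB, coefC, coefXn) /= !eqSS (ltn_eqF (ltnSn _)).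
rewrite (ltn_eqF (ltnW (ltnSn _))) /= subr0 sub0r sqrrN expr1n => /(_ erefl erefl).
by rewrite expr0n mul0rn subr0 lern0.
Qed.
End Bounds.

(** * Graphs up to isolated vertices *)

(** An induced copy of [H] that carries every edge of [G]: this says that [G] is [H] plus isolated
    vertices without naming those vertices. Symmetry of [adj] puts the second endpoint in the image
    too. *)
Definition embeds (H G : sgraph) : Prop :=
  exists g : H -> G, [/\ injective g, forall a b, adj (g a) (g b) = adj a b &
    forall x y, adj x y -> exists a, x = g a].

Lemma giso_embeds (G H : sgraph) (m : nat) :
  giso G (gunion H (gcopies m (K_ 1))) -> embeds H G.
Proof.
case=> f [f' fK f'K] fadj; exists (fun a => f' (inl a)); split=> [a b|a b|x y].
- by move/(can_inj f'K) => -[].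
- by rewrite -fadj !f'K.
- rewrite -fadj; case ex: (f x) => [a|[i j]]; first by exists a; rewrite -ex fK.
  by case: (f y) => [//|[i' j']]; rewrite /= /gcopies_adj /= /ord_adj !ord1 eqxx andbF.
Qed.

Lemma embeds_giso (G H : sgraph) :
  embeds H G -> giso G (gunion H (gcopies (#|G| - #|H|) (K_ 1))).
Proof.
case=> g [ginj gadj gcov]; pose W : {set G} := ~: [set x in codom g].
have cW : #|W| = (#|G| - #|H|)%N by rewrite cardsCs setCK cardsE card_codom.
pose h (a : gunion H (gcopies (#|G| - #|H|) (K_ 1))) : G :=
  match a with
  | inl a => g a
  | inr b => enum_val (cast_ord (esym cW) b.1)
  end.
have hW b : h (inr b) \notin codom g by have := enum_valP (cast_ord (esym cW) b.1); rewrite !inE.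
have hinj : injective h.
  move=> [a|[i j]] [a'|[i' j']] e.
  - by rewrite (ginj _ _ e).
  - by have /negP[] := hW (i', j'); rewrite -e; apply: codom_f.
  - by have /negP[] := hW (i, j); rewrite e; apply: codom_f.
  - by move/enum_val_inj/cast_ord_inj: e => /= ->; rewrite (ord1 j) (ord1 j').
have [f hK fK] : bijective h.
  apply: inj_card_bij => //; rewrite card_sum card_prod !card_ord muln1.
  by rewrite -cW -leq_subLR cW.
exists f; first by exists h.
move=> x y; rewrite -{2}(fK x) -{2}(fK y).
have iso z t : z \notin codom g -> adj z t = false.
  by move=> nz; apply: contraNF nz => /gcov [a ->]; apply: codom_f.
case: (f x) => [a|b]; case: (f y) => [a'|b'].
- by rewrite /= gadj.
- by rewrite [RHS]adj_sym iso.
- by rewrite iso.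
- by rewrite iso // /= /gcopies_adj /= /ord_adj !ord1 eqxx andbF.
Qed.

(** Exhibits a copy of a graph on ['I_m] by listing its vertices in order, which leaves a finite
    adjacency table to check. *)
Lemma embeds_ord_graph (G : sgraph) (m : nat) (e : rel nat) (x0 : G) (s : seq G) :
    size s = m -> uniq s -> (forall x y, adj x y -> x \in s) ->
    (forall i j, (i < m)%N -> (j < m)%N ->
      adj (nth x0 s i) (nth x0 s j) = (i != j) && (e i j || e j i)) ->
  embeds (ord_graph m e) G.
Proof.
move=> szs us scov sadj; exists (fun i : 'I_m => nth x0 s i); split=> [i j|i j|x y xy].
- by move/eqP; rewrite nth_uniq ?szs // => /eqP/val_inj.
- by rewrite sadj.
- have xs := scov _ _ xy; have := xs; rewrite -index_mem szs => lt.
  by exists (Ordinal lt); rewrite /= nth_index.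
Qed.

(** * Vertex covers of size two *)

Section Covers.
Variable G : sgraph.

Definition cover2 (u v : G) : Prop :=
  forall x y, adj x y -> (x \in [set u; v]) || (y \in [set u; v]).

(** An edge avoiding [u] must meet both [v] and [w], hence is the edge between them; it exists
    because [u] alone is not a cover. *)
Lemma cover2_edge_star (u v w : G) : u != v -> u != w -> v != w ->
  cover2 u v -> cover2 u w -> ~ star_at u -> edge_star u v w.
Proof.
move=> uv uw vw cv cw nst.
have H x y : adj x y -> [|| x == u, y == u, (x == v) && (y == w) | (x == w) && (y == v)].
  move=> xy; have := cv _ _ xy; have := cw _ _ xy; rewrite !inE.
  case: (x == u) => //=; case: (y == u) => //=; rewrite ?orbT //.
  have [->|_] := eqVneq x v; first by rewrite (negbTE vw) /= => ->.
  by move=> /= + /eqP yv; rewrite yv eqxx (negbTE vw) orbF andbT.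
split; rewrite 1?eq_sym //.
have [xy|no] := boolP [exists x, exists y, [&& adj x y, x != u & y != u]].
  case/existsP: xy => x /existsP[y /and3P[xy xu yu]].
  move: (H _ _ xy); rewrite (negbTE xu) (negbTE yu) /=.
  by case/orP=> /andP[/eqP <- /eqP <-] //; rewrite adj_sym.
case: nst => x y xy; apply: contraNT no; rewrite negb_or => /andP[xu yu].
by apply/existsP; exists x; apply/existsP; exists y; rewrite xy xu.
Qed.

Lemma card2_mem (E : {set G}) (u : G) : #|E| = 2 -> u \in E ->
  exists2 v, u != v & E = [set u; v].
Proof.
move=> E2 uE; have /cards1P[v Ev] : #|E :\ u| == 1.
  by move: (cardsD1 u E); rewrite uE E2; lia.
exists v; last by rewrite -Ev setD1K.
by have := set11 v; rewrite -Ev !inE eq_sym => /andP[].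
Qed.

(** Covers with a common vertex give a star with an edge at once. If they are disjoint, every edge
    joins [E] to [F]: either all four pairs are edges, or a missing pair yields another cover that
    shares a vertex with [E]. *)
Lemma cover2_cases (E F : {set G}) : E != F -> #|E| = 2 -> #|F| = 2 ->
    (forall x y, adj x y -> (x \in E) || (y \in E)) ->
    (forall x y, adj x y -> (x \in F) || (y \in F)) ->
    (forall u : G, ~ star_at u) ->
  (exists u v w : G, edge_star u v w) \/
  ([disjoint E & F] /\
   forall x y, adj x y = (x \in E) && (y \in F) || (x \in F) && (y \in E)).
Proof.
move=> EF E2 F2 cE cF nst.
have [dEF|/pred0Pn[u /andP[/= uE uF]]] := boolP [disjoint E & F]; last first.
  left; have [v uv Ev] := card2_mem E2 uE; have [w uw Fw] := card2_mem F2 uF.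
  exists u, v, w; apply: cover2_edge_star => //; rewrite /cover2 -?Ev -?Fw //.
  by apply: contraNneq EF => vw; rewrite Ev Fw vw.
have [full|] := boolP [forall p in E, forall q in F, adj p q].
  right; split=> // x y.
  have adjEF p q : p \in E -> q \in F -> adj p q.
    by move=> pE qF; apply: (forall_inP (forall_inP full p pE)).
  apply/idP/idP => [xy|/orP[]/andP[xi yi]]; last 2 first.
  - exact: adjEF.
  - by rewrite adj_sym adjEF.
  have := cF _ _ xy; case/orP: (cE _ _ xy) => [xE|yE].
    by rewrite (disjointFr dEF xE) xE /= => ->.
  by rewrite (disjointFr dEF yE) yE /= orbF andbT => ->; rewrite orbT.
rewrite negb_forall_in => /exists_inP[p pE]; rewrite negb_forall_in => /exists_inP[q qF npq].
left; have [e pe Ee] := card2_mem E2 pE; have [f qf Ff] := card2_mem F2 qF.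
have eE : e \in E by rewrite Ee !inE eqxx orbT.
have fF : f \in F by rewrite Ff !inE eqxx orbT.
have dis x y : x \in E -> y \in F -> x != y.
  by move=> xE yF; apply: contraTneq yF => <-; rewrite (disjointFr dEF).
have ep : cover2 e p by rewrite /cover2 setUC -Ee.
exists e, f, p; apply: cover2_edge_star => //; [exact: dis|by rewrite eq_sym|by rewrite eq_sym dis|].
(* An edge between [E] and [F] that avoids both [e] and [f] would be the missing pair [p], [q]; so
   [e] and [f] form a cover. *)
have cef x y : x \in E -> y \in F -> adj x y -> (x \in [set e; f]) || (y \in [set e; f]).
  rewrite Ee Ff !inE => /orP[]/eqP-> /orP[]/eqP->; rewrite ?eqxx ?orbT //.
  by rewrite (negbTE npq).
move=> x y xy; have := cF _ _ xy; case/orP: (cE _ _ xy) => [xE|yE].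
  by rewrite (disjointFr dEF xE) /= => yF; apply: cef.
rewrite (disjointFr dEF yE) orbF => xF; rewrite orbC; apply: cef => //.
by rewrite adj_sym.
Qed.

Lemma dep_count_all (k : nat) : (forall S : {set G}, #|S| = k -> dependent S) ->
  dep_count G k = 'C(#|G|, k).
Proof.
move=> H; rewrite -card_draws; apply: eq_card => S; rewrite !inE.
by case: eqP => [/H ->|]; rewrite ?andbF.
Qed.

Lemma dep_count_small (k : nat) : (k < 2)%N -> dep_count G k = 0.
Proof.
move=> k2; apply/eqP; rewrite cards_eq0 -subset0; apply/subsetP => S.
rewrite !inE => /andP[/dependentP[x [y [xS yS xy]]] /eqP Sk].
have : (1 < #|S|)%N.
  apply/card_gt1P; exists x, y; split=> //.
  by apply: contraTneq xy => ->; rewrite adj_irr.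
by rewrite Sk ltnNge -ltnS k2.
Qed.

Lemma indep_cover (S : {set G}) : ~~ dependent S ->
  forall x y, adj x y -> (x \in ~: S) || (y \in ~: S).
Proof.
move=> nS x y xy; apply: contraNT nS; rewrite !inE negb_or !negbK => /andP[xS yS].
by apply/dependentP; exists x, y.
Qed.

Lemma two_cover2 (C : numClosedFieldType) : (exists x y : G, adj x y) ->
    (forall u : G, ~ star_at u) -> real_rooted (dep_poly C G) ->
  exists E F : {set G}, [/\ E != F, #|E| = 2, #|F| = 2,
    (forall x y, adj x y -> (x \in E) || (y \in E)) &
    (forall x y, adj x y -> (x \in F) || (y \in F))].
Proof.
move=> [a [b ab]] nst rr.
have G2 : (1 < #|G|)%N.
  by apply/card_gt1P; exists a, b; split=> //; apply: contraTneq ab => ->; rewrite adj_irr.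
have [k Gk] : exists k, #|G| = k.+2 by exists (#|G| - 2)%N; lia.
set p := dep_poly C G in rr.
have pn : p`_k.+2 = 1.
  rewrite coef_dep_poly dep_count_all ?Gk ?binn // => S Sk.
  have -> : S = setT by apply/eqP; rewrite eqEcard subsetT cardsT Gk Sk /=.
  by apply/dependentP; exists a, b.
(* An independent set of size n - 1 would leave a single vertex covering all edges. *)
have pn1 : p`_k.+1 = k.+2%:R.
  rewrite coef_dep_poly dep_count_all ?Gk ?binSn // => S Sk.
  rewrite -[dependent S]negbK; apply/negP => /indep_cover cS.
  have /cards1P[u Su] : #|~: S| == 1 by rewrite cardsCs setCK Gk Sk subSnn.
  by apply: (nst u) => x y xy; have := cS _ _ xy; rewrite Su !inE.
have sp : size p = k.+3.
  apply/eqP; rewrite eqn_leq; apply/andP; split; last first.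
    by rewrite ltnNge; apply/negP => /(nth_default 0) /eqP; rewrite pn oner_eq0.
  apply/leq_sizeP => j jk; rewrite coef_dep_poly.
  rewrite /dep_count (_ : [set _ | _] = set0) ?cards0 //.
  apply/setP => S; rewrite !inE; apply/negP => /andP[_ /eqP Sj].
  by have := max_card (mem S); rewrite Sj Gk leqNgt jk.
have mp : p \is monic by rewrite monicE lead_coefE sp pn.
(* The complements of these independent sets are the vertex covers of size 2. *)
pose I := [set S : {set G} | ~~ dependent S & #|S| == k].
have dI : (dep_count G k + #|I| = 'C(k.+2, 2))%N.
  rewrite -(bin_sub (isT : 2 <= k.+2)%N) subn2 /= -Gk -card_draws.
  rewrite -(cardsID [set S : {set G} | dependent S] [set S : {set G} | #|S| == k]); congr (_ + _)%N;
    by apply: eq_card => S; rewrite !inE // andbC.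
have I2 : (1 < #|I|)%N.
  (* With n = k + 2 and i the size of [I], the root bound reads n^2 <= (n - 2)(n + 2i); but (n -
     2)(n + 2) = n^2 - 4, so i <= 1 is impossible. *)
  rewrite ltnNge; apply/negP => I1.
  have pz i : (i < 2)%N -> p`_i = 0 by move=> i2; rewrite coef_dep_poly dep_count_small.
  have := real_rooted_double_zero mp sp (pz 0%N isT) (pz 1%N isT) rr.
  rewrite pn1 coef_dep_poly.
  rewrite mulrBr lerBrDr -mulrnA -natrX -!natrM -natrD ler_nat.
  have b2 : ('C(k.+2, 2) * 2 = k.+2 * k.+1)%N.
    by rewrite -[X in (_ * X)%N]/(2`!) bin_ffact !ffactSS ffactn0 muln1.
  rewrite -dI in b2; rewrite expnS expn1; nia.
case/card_gt1P: I2 => S [T [SI TI ST]]; exists (~: S), (~: T).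
move: SI TI; rewrite !inE => /andP[dS /eqP Sk] /andP[dT /eqP Tk].
split; [by rewrite (inj_eq (@setC_inj _)) | | |exact: indep_cover|exact: indep_cover];
  rewrite cardsCs setCK Gk; lia.
Qed.
End Covers.

(** * Real-rootedness forces one of the listed graphs *)

Lemma real_rooted_dvdr (C : numClosedFieldType) (p q : {poly C}) :
  real_rooted (p * q) -> real_rooted q.
Proof. by move=> rr z qz; apply: rr; rewrite rootM qz orbT. Qed.

Ltac simp_neq :=
  rewrite ?eqxx;
  repeat match goal with
  | H : is_true (?a != ?b) |- context [?a == ?b] => rewrite (negbTE H)
  | H : is_true (?a != ?b) |- context [?b == ?a] => rewrite (eq_sym b a) (negbTE H)
  end.

Lemma star_embeds (C : numClosedFieldType) (G : sgraph) (u : G) :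
    star_at u -> (exists x y : G, adj x y) -> real_rooted (dep_poly C G) ->
  embeds (K_ 2) G \/ embeds (P_ 3) G.
Proof.
move=> st [a [b ab]] rr.
have adjE x y : adj x y = (x == u) && (y \in nbr u) || (y == u) && (x \in nbr u).
  rewrite !inE; apply/idP/idP => [xy|/orP[]/andP[/eqP-> //]]; last by rewrite adj_sym.
  by case/orP: (st _ _ xy) => /eqP e; rewrite -e eqxx ?xy // [adj y x]adj_sym xy orbT.
have uN x : x \in nbr u -> u != x.
  by apply: contraTneq => <-; rewrite inE adj_irr.
case Nd: #|nbr u| => [|[|[|d]]].
- by move: ab; rewrite adjE (cards0_eq Nd) !inE !andbF.
- left; have /cards1P [v Nv] : #|nbr u| == 1 by rewrite Nd.
  have uv : u != v by apply: uN; rewrite Nv set11.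
  apply: (@embeds_ord_graph _ _ _ u [:: u; v]) => //=.
  + by rewrite inE uv.
  + by move=> x y; rewrite adjE Nv !inE; case: (x == u); case: (x == v); rewrite ?andbF.
  + by move=> [|[|i]] [|[|j]] // _ _ /=;
      rewrite adjE Nv !inE; simp_neq.
- right; have /cards2P [v [w [vw Nv]]] : #|nbr u| == 2 by rewrite Nd.
  have uv : u != v by apply: uN; rewrite Nv !inE eqxx.
  have uw : u != w by apply: uN; rewrite Nv !inE eqxx orbT.
  apply: (@embeds_ord_graph _ _ _ u [:: v; u; w]) => //=.
  + by rewrite !inE negb_or eq_sym uv vw uw.
  + by move=> x y; rewrite adjE Nv !inE; case: (x == u); case: (x == v); case: (x == w); rewrite ?andbF.
  + by move=> [|[|[|i]]] [|[|[|j]]] // _ _ /=;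
      rewrite adjE Nv !inE; simp_neq.
(* With d + 3 neighbours, every root of unity y of that order gives the root y - 1 of D. *)
- case: (@XnsubC1_not_real_rooted C d) => y.
  rewrite /root !hornerE => /eqP y1.
  have : root (dep_poly C G) (y - 1).
    by rewrite /root (dep_eval_star _ st) Nd [1 + _]addrC subrK y1 mulr0.
  by move/rr => h; rewrite -[y](subrK 1) rpredD ?rpred1.
Qed.

Section EdgeStarEmbeds.
Variables (C : numClosedFieldType) (G : sgraph).

Lemma mem_nbr_legs (u v w x : G) :
  (x \in nbr u) = [|| x \in legs u v w, (x == v) && adj u v | (x == w) && adj u w].
Proof.
rewrite !inE; have [->|_] := eqVneq x v => /=; first by case: eqP => [<-|]; rewrite ?orbb ?orbF.
by have [->|_] := eqVneq x w; rewrite ?orbF.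
Qed.

(** A root y of the reduced polynomial gives the root y - 1 of D, and the shift by 1 preserves
    reality. *)
Lemma edge_star_real_rooted (u v w : G) (q : {poly C}) : edge_star u v w ->
    (forall y, q.[y] = if adj u v && adj u w then 1
                       else if adj u v || adj u w then y else 2 * y - 1) ->
    real_rooted (dep_poly C G) ->
  let t := #|legs u v w| in real_rooted ('X^(t.+2) + 'X^(t.+1) - 'X^t - q).
Proof.
move=> es qE rr t y; rewrite /root !(hornerE, hornerXn) qE => /eqP y0.
have : root (dep_poly C G) (y - 1) by rewrite /root (dep_eval_legs es) y0 mulr0.
by move/rr => h; rewrite -[y](subrK 1) rpredD ?rpred1.
Qed.

Lemma edge_star_sym (u v w : G) : edge_star u v w -> edge_star u w v.
Proof.
case=> vw vu wu H; split=> //; first by rewrite adj_sym.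
by move=> x y /H; case/or4P=> ->; rewrite ?orbT.
Qed.

(** Bridges the two encodings: [gcopies] lives on pairs, listed vertices on ['I_4]; [k] reads a pair
    as a two-digit binary number. *)
Lemma embeds_2K2 : embeds (ord_graph 4 (fun i j => (i, j) \in [:: (0, 1); (2, 3)]%N)) G ->
  embeds (gcopies 2 (K_ 2)) G.
Proof.
case=> g [ginj gadj gcov].
pose k (p : 'I_2 * 'I_2) : 'I_4 := inord (p.1 * 2 + p.2).
have kE p : k p = (p.1 * 2 + p.2)%N :> nat.
  by rewrite inordK //; case: p => -[[|[|i]] // ?] [[|[|j]] // ?].
have kinj : injective k.
  move=> p q /(congr1 val) /=; rewrite !kE; case: p q => [i j] [i' j'] /= e.
  by congr (_, _); apply: val_inj => /=; have := ltn_ord j; have := ltn_ord j'; lia.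
have [k' _ kK] : bijective k by apply: inj_card_bij => //; rewrite card_prod !card_ord.
exists (g \o k); split=> [|p q|x y /gcov[a ->]]; first exact: inj_comp.
  rewrite /= gadj /= /ord_adj -val_eqE /= !kE.
  by case: p q => [[[|[|i]] // ?] [[|[|j]] // ?]] [[[|[|i']] // ?] [[|[|j']] // ?]].
by exists (k' a); rewrite /= kK.
Qed.

(** If [u] sees both [v] and [w], zero or one leg gives [K_ 3] or [G1]; if it sees one, one or two
    legs give [P_ 4] or [G2]; if none, one leg gives two disjoint edges. More legs contradict
    real-rootedness. *)
Lemma edge_star_embeds (u v w : G) : edge_star u v w ->
    (forall x : G, ~ star_at x) -> real_rooted (dep_poly C G) ->
  embeds (K_ 3) G \/ embeds (gcopies 2 (K_ 2)) G \/ embeds (P_ 4) G \/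
  embeds G1 G \/ embeds G2 G.
Proof.
(* Swapping [v] and [w] if necessary, [v] is the neighbour of [u] when there is just one. *)
wlog auv : v w / adj u w -> adj u v.
  move=> th es; case uw: (adj u w); last by apply: (th v w) => //; rewrite uw.
  by apply: (th w v) => //; apply: edge_star_sym.
move=> es nst rr; have adjE := edge_star_adjE es; have vw := edge_star_neq es.
have rrq q qE := @edge_star_real_rooted u v w q es qE rr.
have Nl := mem_nbr_legs u v w; have [_ vu wu _] := es.
have legsP x : x \in legs u v w -> [&& x != u, x != v & x != w].
  by rewrite !inE negb_or => /andP[/andP[-> ->]]; rewrite !andbT; apply: contraTneq => ->; rewrite adj_irr.
case uw: (adj u w); [have uv := auv uw | case uv: (adj u v)].
- case tE: #|legs u v w| => [|[|t]].
  + left.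
    apply: (@embeds_ord_graph _ _ _ u [:: u; v; w]) => //=.
    + by rewrite !inE; simp_neq.
    + by move=> x y; rewrite adjE !Nl (cards0_eq tE) !inE uv uw;
         case: (x == u); case: (x == v); case: (x == w); rewrite ?andbF.
    + by move=> [|[|[|i]]] [|[|[|j]]] // _ _ /=;
         rewrite adjE !Nl (cards0_eq tE) !inE uv uw; simp_neq.
  + do 3 right; left; have /cards1P[l Ll] : #|legs u v w| == 1 by rewrite tE.
    have /and3P[lu lv lw] : [&& l != u, l != v & l != w] by apply: legsP; rewrite Ll set11.
    (* The vertex of [G1] that carries the pendant edge has number 1, so [u] comes second. *)
    apply: (@embeds_ord_graph _ _ _ u [:: v; u; w; l]) => //=.
    + by rewrite !inE; simp_neq.
    + by move=> x y; rewrite adjE !Nl Ll !inE uv uw;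
         case: (x == v); case: (x == u); case: (x == w); case: (x == l); rewrite ?andbF.
    + by move=> [|[|[|[|i]]]] [|[|[|[|j]]]] // _ _ /=;
         rewrite adjE !Nl Ll !inE uv uw; simp_neq.
  + have := rrq 1; rewrite tE uv uw => /(_ (fun y => hornerC _ _)) /edge_star_poly_not_real_rooted [].
      by rewrite size_poly1.
    by rewrite coefC expr1n.
- case tE: #|legs u v w| => [|[|[|t]]].
  (* Without legs this is the path u, v, w, a star at [v]. *)
  + exfalso; apply: (nst v) => x y; rewrite adjE !Nl (cards0_eq tE) !inE uv uw.
    by case: (x == v); case: (y == v); rewrite ?andbF ?andbT ?orbT.
  + do 2 right; left; have /cards1P[l Ll] : #|legs u v w| == 1 by rewrite tE.
    have /and3P[lu lv lw] : [&& l != u, l != v & l != w] by apply: legsP; rewrite Ll set11.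
    apply: (@embeds_ord_graph _ _ _ u [:: l; u; v; w]) => //=.
    + by rewrite !inE; simp_neq.
    + by move=> x y; rewrite adjE !Nl Ll !inE uv uw;
         case: (x == l); case: (x == u); case: (x == v); case: (x == w); rewrite ?andbF.
    + by move=> [|[|[|[|i]]]] [|[|[|[|j]]]] // _ _ /=;
         rewrite adjE !Nl Ll !inE uv uw; simp_neq.
  + do 4 right; have /cards2P[l [l' [ll' Ll]]] : #|legs u v w| == 2 by rewrite tE.
    have /and3P[lu lv lw] : [&& l != u, l != v & l != w] by apply: legsP; rewrite Ll !inE eqxx.
    have /and3P[lu' lv' lw'] : [&& l' != u, l' != v & l' != w].
      by apply: legsP; rewrite Ll !inE eqxx orbT.
    apply: (@embeds_ord_graph _ _ _ u [:: u; v; w; l; l']) => //=.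
    + by rewrite !inE; simp_neq.
    + by move=> x y; rewrite adjE !Nl Ll !inE uv uw;
         case: (x == u); case: (x == v); case: (x == w); case: (x == l); case: (x == l'); rewrite ?andbF.
    + by move=> [|[|[|[|[|i]]]]] [|[|[|[|[|j]]]]] // _ _ /=;
         rewrite adjE !Nl Ll !inE uv uw; simp_neq.
  + have := rrq 'X; rewrite tE uv uw => /(_ (fun y => hornerX _)) /=.
    (* Removing the factor X lowers the degree by one, so it takes three legs instead of two to
       exceed degree 3. *)
    rewrite (_ : _ - 'X = 'X * ('X^(t.+4) + 'X^(t.+3) - 'X^(t.+2) - 1)); last by rewrite !exprS; ring.
    move/real_rooted_dvdr/edge_star_poly_not_real_rooted => [].
      by rewrite size_poly1.
    by rewrite coefC expr1n.
- case tE: #|legs u v w| => [|[|t]].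
  + exfalso; apply: (nst v) => x y; rewrite adjE !Nl (cards0_eq tE) !inE uv uw.
    by case: (x == v); case: (y == v); rewrite ?andbF ?andbT ?orbT.
  + right; left; have /cards1P[l Ll] : #|legs u v w| == 1 by rewrite tE.
    have /and3P[lu lv lw] : [&& l != u, l != v & l != w] by apply: legsP; rewrite Ll set11.
    apply: embeds_2K2.
    apply: (@embeds_ord_graph _ _ _ u [:: u; l; v; w]) => //=.
    + by rewrite !inE; simp_neq.
    + by move=> x y; rewrite adjE !Nl Ll !inE uv uw;
         case: (x == u); case: (x == l); case: (x == v); case: (x == w); rewrite ?andbF.
    + by move=> [|[|[|[|i]]]] [|[|[|[|j]]]] // _ _ /=;
         rewrite adjE !Nl Ll !inE uv uw; simp_neq.
  + pose q : {poly C} := 2%:P * 'X - 1.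
    have qE y : q.[y] = 2 * y - 1 by rewrite /q !hornerE.
    have := rrq q; rewrite tE uv uw => /(_ qE) /edge_star_poly_not_real_rooted [].
      rewrite (leq_trans (size_polyD _ _)) // size_polyN size_poly1 geq_max.
      by rewrite mul_polyC (leq_trans (size_scale_leq _ _)) ?size_polyX.
    by rewrite coefB coefMX coef1 sub0r sqrrN expr1n.
Qed.
End EdgeStarEmbeds.

Lemma C4_embeds (G : sgraph) (E F : {set G}) : [disjoint E & F] -> #|E| = 2 -> #|F| = 2 ->
    (forall x y, adj x y = (x \in E) && (y \in F) || (x \in F) && (y \in E)) ->
  embeds (C_ 4) G.
Proof.
move=> dEF /eqP/cards2P[a [b [ab Eab]]] /eqP/cards2P[c [d [cd Fcd]]] adjE.
have dis x y : x \in E -> y \in F -> x != y.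
  by move=> xE yF; apply: contraTneq yF => <-; rewrite (disjointFr dEF).
have aE : a \in E by rewrite Eab !inE eqxx.
have bE : b \in E by rewrite Eab !inE eqxx orbT.
have cF : c \in F by rewrite Fcd !inE eqxx.
have dF : d \in F by rewrite Fcd !inE eqxx orbT.
have ac := dis _ _ aE cF; have ad := dis _ _ aE dF.
have bc := dis _ _ bE cF; have bd := dis _ _ bE dF.
(* Alternating between the two sides gives the cyclic order. *)
apply: (@embeds_ord_graph _ _ _ a [:: a; c; b; d]) => //=.
- by rewrite !inE; simp_neq.
- move=> x y; rewrite adjE Eab Fcd !inE.
  by case: (x == a); case: (x == b); case: (x == c); case: (x == d).
- by move=> [|[|[|[|i]]]] [|[|[|[|j]]]] // _ _ /=; rewrite adjE Eab Fcd !inE; simp_neq.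
Qed.

(** * Neighbourhoods, stars and legs under an embedding *)

Section Transport.
Variables (H G : sgraph) (g : H -> G).
Hypotheses (ginj : injective g) (gadj : forall a b, adj (g a) (g b) = adj a b).
Hypothesis gcov : forall x y, adj x y -> exists a, x = g a.

Lemma embed_edge (x y : G) : adj x y -> exists a b, [/\ x = g a, y = g b & adj a b].
Proof.
move=> xy; have [a xa] := gcov xy; have [b yb] : exists b, y = g b.
  by apply: (gcov (y := x)); rewrite adj_sym.
by exists a, b; rewrite -gadj -xa -yb.
Qed.

Lemma embed_nbr (u : H) : nbr (g u) = g @: nbr u.
Proof.
apply/setP => x; apply/idP/imsetP => [|[a]]; rewrite inE.
  by case/embed_edge => a [b [/ginj<- -> ub]]; exists b; rewrite ?inE.
by move=> ua ->; rewrite inE gadj.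
Qed.

Lemma embed_star_at (u : H) : star_at u -> star_at (g u).
Proof. by move=> st x y /embed_edge[a [b [-> -> /st]]]; rewrite !(inj_eq ginj). Qed.

Lemma embed_edge_star (u v w : H) : edge_star u v w -> edge_star (g u) (g v) (g w).
Proof.
case=> vw vu wu es; split; rewrite ?gadj ?(inj_eq ginj) // => x y.
by case/embed_edge => a [b [-> -> /es]]; rewrite !(inj_eq ginj).
Qed.

Lemma embed_legs (u v w : H) : #|legs (g u) (g v) (g w)| = #|legs u v w|.
Proof.
rewrite /legs embed_nbr -[RHS](card_imset _ ginj); apply: eq_card => x.
apply/setDP/imsetP => [[/imsetP[a ua ->] na]|[a]].
  by exists a => //; rewrite !inE in na ua *; rewrite !(inj_eq ginj) in na; rewrite na.
by case/setDP => ua na ->; rewrite imset_f //; split=> //; rewrite !inE !(inj_eq ginj) in na *.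
Qed.
End Transport.

(** * The listed graphs have real-rooted dependence polynomials *)

Section RealRootedFamilies.
Variables (C : numClosedFieldType) (G : sgraph).

Lemma star_real_rooted (u : G) :
    star_at u -> (#|nbr u| == 1) || (#|nbr u| == 2) -> real_rooted (dep_poly C G).
Proof.
move=> st Nu z; rewrite /root (dep_eval_star _ st) !mulf_eq0 expf_eq0 => /orP[/orP[/eqP->|]|].
- exact: rpred0.
- by case/andP=> _ /eqP e; rewrite -[z](addKr 1) e rpredD ?rpredN1 ?rpred0.
case/orP: Nu => /eqP->; first by rewrite expr1 addrAC subrr add0r => /eqP->; apply: rpred0.
rewrite (_ : _ - 1 = z * (z + 2)) ?mulf_eq0; last by ring.
case/orP=> [/eqP->|]; first exact: rpred0.
by rewrite addr_eq0 => /eqP->; rewrite rpredN realn.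
Qed.

(** The other factors of D vanish only at y = 1 and y = 0, so the reduced polynomial alone
    decides. *)
Lemma edge_star_real_rootedI (u v w : G) : edge_star u v w ->
    (let t := #|legs u v w| in forall y : C,
     y ^+ t.+2 + y ^+ t.+1 - y ^+ t -
     (if adj u v && adj u w then 1 else if adj u v || adj u w then y else 2 * y - 1) = 0 ->
     y \is Num.real) ->
  real_rooted (dep_poly C G).
Proof.
move=> es Hy z; rewrite /root -[z](addrK 1) (dep_eval_legs es) !mulf_eq0 expf_eq0.
rewrite -orbA => h; rewrite rpredB ?rpred1 //; case/or3P: h => [|/andP[_ /eqP->]|/eqP/Hy //].
  by rewrite subr_eq0 => /eqP->; apply: rpred1.
exact: rpred0.
Qed.

Lemma C4_real_rooted (E F : {set G}) : [disjoint E & F] -> #|E| = 2 -> #|F| = 2 ->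
    (forall x y, adj x y = (x \in E) && (y \in F) || (x \in F) && (y \in E)) ->
  real_rooted (dep_poly C G).
Proof.
move=> dEF E2 F2 adjE z; rewrite /root (dep_eval_C4 _ dEF E2 F2 adjE) mulf_eq0 !expf_eq0.
case/orP=> [/andP[_ /eqP e]|/andP[_]].
  by rewrite -[z](addKr 1) e rpredD ?rpredN1 ?rpred0.
rewrite (_ : _ - 1 = z * (z + 2)) ?mulf_eq0; last by ring.
case/orP=> [/eqP->|]; first exact: rpred0.
by rewrite addr_eq0 => /eqP->; rewrite rpredN realn.
Qed.

(** The reduced polynomial is computed inside the small graph [H], whatever the number of isolated
    vertices of [G]. *)
Lemma embeds_edge_star_real_rooted (H : sgraph) (u v w : H) : embeds H G -> edge_star u v w ->
    (let t := #|legs u v w| in forall y : C,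
     y ^+ t.+2 + y ^+ t.+1 - y ^+ t -
     (if adj u v && adj u w then 1 else if adj u v || adj u w then y else 2 * y - 1) = 0 ->
     y \is Num.real) ->
  real_rooted (dep_poly C G).
Proof.
case=> g [ginj gadj gcov] es Hy.
apply: (edge_star_real_rootedI (embed_edge_star ginj gadj gcov es)).
by rewrite (embed_legs ginj gadj gcov) !gadj.
Qed.

Ltac ord_cases := by move=> [[|[|[|[|[|?]]]]] // ?] [[|[|[|[|[|?]]]]] // ?].
Ltac ord_set := by apply/setP => -[[|[|[|[|[|?]]]]] // ?]; rewrite !inE.

Lemma K2_real_rooted : embeds (K_ 2) G -> real_rooted (dep_poly C G).
Proof.
case=> g [ginj gadj gcov]; pose u : K_ 2 := @Ordinal 2 0 isT.
apply: (@star_real_rooted (g u)).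
  by apply: embed_star_at => //; ord_cases.
rewrite (embed_nbr ginj gadj gcov) card_imset //.
by rewrite (_ : nbr u = [set (@Ordinal 2 1 isT)]) ?cards1 //; ord_set.
Qed.

Lemma P3_real_rooted : embeds (P_ 3) G -> real_rooted (dep_poly C G).
Proof.
case=> g [ginj gadj gcov]; pose u : P_ 3 := @Ordinal 3 1 isT.
apply: (@star_real_rooted (g u)).
  by apply: embed_star_at => //; ord_cases.
rewrite (embed_nbr ginj gadj gcov) card_imset //.
by rewrite (_ : nbr u = [set (@Ordinal 3 0 isT); (@Ordinal 3 2 isT)]) ?cards2 //; ord_set.
Qed.

Lemma shift_root_real (y c : C) : c \is Num.real -> y + c == 0 -> y \is Num.real.
Proof. by move=> cR; rewrite addr_eq0 => /eqP->; rewrite rpredN. Qed.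

Lemma K3_real_rooted : embeds (K_ 3) G -> real_rooted (dep_poly C G).
Proof.
pose o k (lt : (k < 3)%N) : (K_ 3) := Ordinal lt.
move/(@embeds_edge_star_real_rooted _ (o 0 isT) (o 1 isT) (o 2 isT)); apply.
  by split=> //; ord_cases.
rewrite (_ : legs _ _ _ = set0) ?cards0 => [/= y|]; last by ord_set.
rewrite (_ : _ - _ = (y - 1) * (y + 2)); last by ring.
move/eqP; rewrite mulf_eq0 => /orP[]; apply: shift_root_real;
  by rewrite ?rpredN ?rpred0 ?rpred1 ?realn.
Qed.

Lemma P4_real_rooted : embeds (P_ 4) G -> real_rooted (dep_poly C G).
Proof.
pose o k (lt : (k < 4)%N) : (P_ 4) := Ordinal lt.
move/(@embeds_edge_star_real_rooted _ (o 1 isT) (o 2 isT) (o 3 isT)); apply.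
  by split=> //; ord_cases.
rewrite (_ : legs _ _ _ = [set o 0 isT]) ?cards1 => [/= y|]; last by ord_set.
(* The factor y is written [y - 0] to have the shape [y + c] of [shift_root_real]. *)
rewrite (_ : _ - _ = (y - 0) * ((y - 1) * (y + 2))); last by ring.
move/eqP; rewrite !mulf_eq0 => /or3P[]; apply: shift_root_real;
  by rewrite ?rpredN ?rpred0 ?rpred1 ?realn.
Qed.

Lemma G1_real_rooted : embeds G1 G -> real_rooted (dep_poly C G).
Proof.
pose o k (lt : (k < 4)%N) : G1 := Ordinal lt.
move/(@embeds_edge_star_real_rooted _ (o 1 isT) (o 0 isT) (o 2 isT)); apply.
  by split=> //; ord_cases.
rewrite (_ : legs _ _ _ = [set o 3 isT]) ?cards1 => [/= y|]; last by ord_set.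
rewrite (_ : _ - _ = (y - 1) * ((y + 1) * (y + 1))); last by ring.
move/eqP; rewrite !mulf_eq0 => /or3P[]; apply: shift_root_real;
  by rewrite ?rpredN ?rpred0 ?rpred1 ?realn.
Qed.

Lemma G2_real_rooted : embeds G2 G -> real_rooted (dep_poly C G).
Proof.
pose o k (lt : (k < 5)%N) : G2 := Ordinal lt.
move/(@embeds_edge_star_real_rooted _ (o 0 isT) (o 1 isT) (o 2 isT)); apply.
  by split=> //; ord_cases.
rewrite (_ : legs _ _ _ = [set o 3 isT; o 4 isT]) ?cards2 => [/= y|]; last by ord_set.
rewrite (_ : _ - _ = (y - 0) * ((y - 1) * ((y + 1) * (y + 1)))); last by ring.
move/eqP; rewrite !mulf_eq0 => /or4P[]; apply: shift_root_real;
  by rewrite ?rpredN ?rpred0 ?rpred1 ?realn.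
Qed.

Lemma two_K2_real_rooted : embeds (gcopies 2 (K_ 2)) G -> real_rooted (dep_poly C G).
Proof.
pose o (a b : 'I_2) : gcopies 2 (K_ 2) := (a, b).
(* One copy of [K_ 2] supplies [u] and its leg, the other is the edge off [u]. *)
move/(@embeds_edge_star_real_rooted _ (o ord0 ord0) (o ord_max ord0) (o ord_max ord_max)); apply.
  split=> //.
  by move=> [[[|[|i]] // ?] [[|[|j]] // ?]] [[[|[|i']] // ?] [[|[|j']] // ?]].
rewrite (_ : legs _ _ _ = [set o ord0 ord_max]) ?cards1 => [/= y|]; last first.
  by apply/setP => -[[[|[|i]] // ?] [[|[|j]] // ?]]; rewrite !inE.
(* Here y^3 + y^2 - 3y + 1 = (y - 1)(y^2 + 2y - 1), and the quadratic has the roots -1 plus or minus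
   the square root of 2. *)
rewrite (_ : _ - _ = (y - 1) * ((y + (1 - sqrtC 2)) * (y + (1 + sqrtC 2)))); last first.
  have := sqrtCK (2 : C); move: (sqrtC _) => r r2.
  have -> : (y + (1 - r)) * (y + (1 + r)) = y ^+ 2 + 2 * y + 1 - r ^+ 2 by ring.
  by rewrite r2; ring.
have rR : sqrtC (2 : C) \is Num.real by rewrite sqrtC_real // ler0n.
move/eqP; rewrite !mulf_eq0 => /or3P[]; apply: shift_root_real.
- by rewrite rpredN rpred1.
- by rewrite rpredB ?rpred1.
- by rewrite rpredD ?rpred1.
Qed.

Lemma C4_embeds_real_rooted : embeds (C_ 4) G -> real_rooted (dep_poly C G).
Proof.
case=> g [ginj gadj gcov]; pose o k (lt : (k < 4)%N) : C_ 4 := Ordinal lt.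
apply: (@C4_real_rooted (g @: [set o 0 isT; o 2 isT]) (g @: [set o 1 isT; o 3 isT])).
- rewrite -setI_eq0 -imsetI; last by move=> ? ? _ _; apply: ginj.
  have -> : [set o 0 isT; o 2 isT] :&: [set o 1 isT; o 3 isT] = set0 by ord_set.
  by rewrite imset0.
- by rewrite card_imset // cards2.
- by rewrite card_imset // cards2.
move=> x y; apply/idP/idP => [/(embed_edge gadj gcov)[a [b [-> -> ]]]|].
  by rewrite !(mem_imset _ _ ginj) !inE; move: a b; ord_cases.
by case/orP=> /andP[/imsetP[a + ->] /imsetP[b + ->]]; rewrite gadj !inE; move: a b; ord_cases.
Qed.
End RealRootedFamilies.

Theorem theorem1p3 (R : realType) (G : sgraph) (n : nat)
    (order_G : #|G| = n) (edge_G : exists x y : G, adj x y) :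
  only_real_roots (dep_poly R[i] G) <->
    (giso G (gunion (K_ 2) (gcopies (n - 2) (K_ 1))) \/
     giso G (gunion (P_ 3) (gcopies (n - 3) (K_ 1))) \/
     giso G (gunion (K_ 3) (gcopies (n - 3) (K_ 1))) \/
     giso G (gunion (gcopies 2 (K_ 2)) (gcopies (n - 4) (K_ 1))) \/
     giso G (gunion (P_ 4) (gcopies (n - 4) (K_ 1))) \/
     giso G (gunion (C_ 4) (gcopies (n - 4) (K_ 1))) \/
     giso G (gunion G1 (gcopies (n - 4) (K_ 1))) \/
     giso G (gunion G2 (gcopies (n - 5) (K_ 1)))).
Proof.
subst n; split=> [rr|].
  have iso (H : sgraph) m : embeds H G -> #|H| = m ->
      giso G (gunion H (gcopies (#|G| - m) (K_ 1))).
    by move=> eH <-; apply: embeds_giso.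
  have ord_iso m e : embeds (ord_graph m e) G ->
      giso G (gunion (ord_graph m e) (gcopies (#|G| - m) (K_ 1))).
    by move/iso; apply; rewrite card_ord.
  (* A vertex covering all edges leads to [K_ 2] or [P_ 3]; otherwise there are two vertex covers of
     size 2. *)
  have [/existsP[u /'forall_'forall_implyP st]|nst] :=
      boolP [exists u : G, forall x, forall y, adj x y ==> (x == u) || (y == u)].
    by case: (star_embeds st edge_G rr) => /ord_iso; tauto.
  have {}nst (u : G) : ~ star_at u.
    move=> st; case/existsP: nst; exists u.
    by apply/'forall_'forall_implyP.
  have [E [F [EF E2 F2 cE cF]]] := two_cover2 edge_G nst rr.
  case: (cover2_cases EF E2 F2 cE cF nst) => [[u [v [w es]]]|[dEF adjE]].
    case: (edge_star_embeds es nst rr) => [/ord_iso|[/iso|[/ord_iso|[/ord_iso|/ord_iso]]]]; try tauto.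
    by rewrite card_prod !card_ord => /(_ _ erefl); tauto.
  by have /ord_iso := C4_embeds dEF E2 F2 adjE; tauto.
do 7?[case=> [/giso_embeds|]]; last move/giso_embeds.
- exact: K2_real_rooted.
- exact: P3_real_rooted.
- exact: K3_real_rooted.
- exact: two_K2_real_rooted.
- exact: P4_real_rooted.
- exact: C4_embeds_real_rooted.
- exact: G1_real_rooted.
- exact: G2_real_rooted.
Qed.
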